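(* Let $X$ be a real Banach space and let $f:\mathbb{R}\to X$ be arbitrary. Then the set $\{x\in\mathbb{R}: mD^+(f,x)\neq mD^-(f,x)\}$ is $\sigma$-porous.
   Context: For $f:\mathbb{R}\to X$ and $x\in\mathbb{R}$, the unilateral upper metric derived numbers are $mD^{\pm}(f,x)=\limsup_{t\to0+}\frac{\|f(x\pm t)-f(x)\|}{t}\in[0,+\infty]$. Porosity: for $M\subset\mathbb{R}$, $x\in M$, $R>0$, let $\gamma(x,R,M)$ be the supremum of all $r>0$ for which there exists $z\in\mathbb{R}$ with $B(z,r)\subset B(x,R)\setminus M$, where $B(z,r)=(z-r,z+r)$ (the supremum is $0$ if there is no such $r$). The upper porosity of $M$ at $x$ is $\overline{p}(M,x)=2\limsup_{R\to0+}\gamma(x,R,M)/R$. The set $M$ is porous if $\overline{p}(M,x)>0$ for all $x\in M$. A set $N\subset\mathbb{R}$ is $\sigma$-porous if it is a countable union of porous sets. *)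

(* Defs.v *)
From HB Require Import structures.
From mathcomp Require Import all_boot all_order all_algebra.
From mathcomp Require Import all_classical all_reals ereal topology normedtype.

Set Implicit Arguments.
Unset Strict Implicit.
Unset Printing Implicit Defensive.

Import Order.TTheory GRing.Theory Num.Theory.
Import numFieldNormedType.Exports.

Local Open Scope classical_set_scope.
Local Open Scope ring_scope.

Section metric_derived_numbers.
Context {R : realType} {X : normedModType R}.
Implicit Types (f : R -> X) (x : R).

Definition mDright f x : \bar R :=
  limf_esup (fun t : R => (`|f (x + t) - f x| / t)%:E) 0^'+.

Definition mDleft f x : \bar R :=
  limf_esup (fun t : R => (`|f (x - t) - f x| / t)%:E) 0^'+.

End metric_derived_numbers.

Section porosity.
Context {R : realType}.
Implicit Types (M N : set R) (x r : R).

(* [sup set0 = 0] in the library, which is the convention wanted when there is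
   no such [r]; otherwise the set is bounded above by [rho], so [sup] is the
   genuine supremum. *)
Definition porosity_gamma x (rho : R) M : R :=
  sup [set r | 0 < r /\ exists z : R, ball z r `<=` ball x rho `\` M].

Definition upper_porosity M x : \bar R :=
  (2%:E * limf_esup (fun rho : R => (porosity_gamma x rho M / rho)%:E) 0^'+)%E.

Definition porous M := forall x, M x -> (0 < upper_porosity M x)%E.

(* The empty set is porous, so unions indexed by [nat] cover finite and empty
   unions as well. *)
Definition sigma_porous N :=
  exists P : nat -> set R, (forall n, porous (P n)) /\ N = \bigcup_n P n.

End porosity.

(* Main.v *)
Require Import Defs.
From HB Require Import structures.
From mathcomp Require Import all_boot all_order all_algebra.
From mathcomp Require Import all_classical all_reals ereal topology normedtype.
From mathcomp Require Import ring lra.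

Import Order.TTheory GRing.Theory Num.Theory.
Import numFieldNormedType.Exports.

Local Open Scope classical_set_scope.
Local Open Scope ring_scope.

(** Suppose that the derived number of [f] at [x] on one side is less than [r],
    uniformly so on the scale [1 / (n + 1)], while on the other side it exceeds
    [s > r].  Then there are arbitrarily small [t] such that
    [|f (x + t) - f x| > s t].  If [w] lies just beyond [x + t] and satisfies the
    same one-sided bound as [x], then looking back from [w] towards both [x] and
    [x + t] gives [|f (x + t) - f x| <= r (w - x) + r (w - x - t)], which
    is impossible when [w - x <= (1 + a) t] and [r (1 + 2 a) < s].  The interval
    from [x + t] to [x + (1 + a) t] is thus a hole of size proportional to its
    distance from [x].  Rational [r], [s] and natural [n] give countably many
    such sets. *)

Section limsup_right.
Context {R : realType}.
Implicit Types (g : R -> R) (c : R).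

(** An infimum of suprema lies below [c] only if a single neighbourhood already has its supremum
    below [c]. *)
Lemma limf_esup_right_lt g c : (limf_esup (fun t => (g t)%:E) 0^'+ < c%:E)%E ->
  exists2 d, 0 < d & forall t, 0 < t < d -> g t < c.
Proof.
rewrite limf_esupE => /ereal_inf_lt[_ [V [d /= d0 dV] <-]] supc.
exists d => // t /andP[t0 td]; rewrite -lte_fin; apply: le_lt_trans supc.
apply: ereal_sup_ubound; exists t => //; apply: dV => //=.
by rewrite sub0r normrN gtr0_norm.
Qed.

Lemma limf_esup_right_gt g c : (c%:E < limf_esup (fun t => (g t)%:E) 0^'+)%E ->
  forall d, 0 < d -> exists2 t, 0 < t < d & c < g t.
Proof.
move=> cg d d0.
have /(lt_le_trans cg) : (limf_esup (fun t => (g t)%:E) 0^'+ <=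
    ereal_sup [set (g t)%:E | t in [set t | 0 < t < d]%R])%E.
  rewrite limf_esupE; apply: ereal_inf_lbound.
  exists [set t | 0 < t < d] => //; exists d => // t /=.
  by rewrite sub0r normrN => + t0; rewrite gtr0_norm// t0.
by move=> /ereal_sup_gt[_ [t td <-]]; rewrite lte_fin => ?; exists t.
Qed.

Lemma limf_esup_right_ge g c :
  (forall d, 0 < d -> exists2 t, 0 < t < d & c <= g t) ->
  (c%:E <= limf_esup (fun t => (g t)%:E) 0^'+)%E.
Proof.
move=> cg; rewrite limf_esupE; apply: le_ereal_inf_tmp => _ [V [d /= d0 dV] <-].
have [t /andP[t0 td] ct] := cg d d0.
apply: (@le_trans _ _ (g t)%:E); first by rewrite lee_fin.
apply: ereal_sup_ubound; exists t => //; apply: dV => //=.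
by rewrite sub0r normrN gtr0_norm.
Qed.

Lemma lte_rat_between (a b : \bar R) : (a < b)%E ->
  exists q : rat, (a < (ratr q)%:E < b)%E.
Proof.
case: a b => [a| |] [b| |] //=.
- rewrite lte_fin => /rat_in_itvoo[q]; rewrite in_itv/= => qab.
  by exists q; rewrite !lte_fin.
- have /rat_in_itvoo[q] : a < a + 1 by rewrite ltrDl.
  rewrite in_itv/= => /andP[aq _] _.
  by exists q; rewrite lte_fin aq ltry.
- have /rat_in_itvoo[q] : b - 1 < b by rewrite ltrBlDr ltrDl.
  rewrite in_itv/= => /andP[_ qb] _.
  by exists q; rewrite lte_fin qb ltNyr.
- by exists 0; rewrite ltNyr ltry.
Qed.

End limsup_right.

Section porosity.
Context {R : realType}.
Implicit Types (M : set R) (x z r rho c : R).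

(** This crude bound makes the set of radii in [porosity_gamma] bounded above, so that its [sup]
    dominates each member. *)
Lemma ball_subset_radius x z r rho :
  0 < r -> ball z r `<=` ball x rho -> r <= 2 * rho.
Proof.
move=> r0 zx.
have /zx : ball z r (z + r / 2).
  by rewrite /ball/= opprD addNKr normrN gtr0_norm; lra.
have /zx : ball z r (z - r / 2).
  by rewrite /ball/= opprB addrC subrK gtr0_norm; lra.
by rewrite /ball/= !ltr_distl => /andP[? ?] /andP[? ?]; lra.
Qed.

Lemma porosity_gamma_ge M x z r rho : 0 < r ->
  ball z r `<=` ball x rho `\` M -> r <= porosity_gamma x rho M.
Proof.
move=> r0 zM; apply: ub_le_sup; last by split => //; exists z.
exists (2 * rho) => r' [r'0 [z' z'M]].
by apply: (@ball_subset_radius x z') => // w /z'M[].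
Qed.

Lemma upper_porosity_gt0 M x c : 0 < c ->
  (forall d, 0 < d -> exists rho z,
    0 < rho < d /\ ball z (c * rho) `<=` ball x rho `\` M) ->
  (0 < upper_porosity M x)%E.
Proof.
move=> c0 holes; apply: mule_gt0; first by rewrite lte_fin.
apply: (@lt_le_trans _ _ c%:E); first by rewrite lte_fin.
apply: limf_esup_right_ge => d /holes[rho [z [/andP[rho0 rhod] zM]]].
exists rho; first by rewrite rho0.
by rewrite ler_pdivlMr//; apply: porosity_gamma_ge zM; rewrite mulr_gt0.
Qed.

Lemma sigma_porous_bigcup (I : countType) (P : I -> set R) :
  (forall i, porous (P i)) -> sigma_porous (\bigcup_i P i).
Proof.
(* Codes that decode to no index contribute the empty set, which is porous. *)
move=> Pp; exists (fun n => if unpickle n is Some i then P i else set0); split.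
  by move=> n; case: unpickle => // x [].
apply/seteqP; split=> [x [i _ Pix]|x [n _]].
  by exists (pickle i) => //; rewrite pickleK.
by case: unpickle => // i Pix; exists i.
Qed.

End porosity.

Section derived_numbers.
Context {R : realType} {X : normedModType R}.
Implicit Types (f : R -> X) (e x r s : R) (n : nat).

(* [mDdir f 1] is mD^+ and [mDdir f (-1)] is mD^-; the sign lets both
   one-sided cases be treated at once. *)
Definition mDdir f e x : \bar R :=
  limf_esup (fun t : R => (`|f (x + e * t) - f x| / t)%:E) 0^'+.

Lemma mDrightE f x : mDright f x = mDdir f 1 x.
Proof. by congr limf_esup; apply/funext => t; rewrite mul1r. Qed.

Lemma mDleftE f x : mDleft f x = mDdir f (-1) x.
Proof. by congr limf_esup; apply/funext => t; rewrite mulN1r. Qed.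

(** The strict inequalities are part of the set, so that for [e] a sign every choice of [r], [s],
    [n] gives a porous set of points whose two derived numbers differ. *)
Definition derived_gap f e r s n : set R :=
  [set x | [/\ (mDdir f (- e) x < r%:E)%E, r < s, (s%:E < mDdir f e x)%E &
    forall t, 0 < t < n.+1%:R^-1 -> `|f (x - e * t) - f x| <= r * t]].

Lemma derived_gap_exists f e x : (mDdir f (- e) x < mDdir f e x)%E ->
  exists q1 q2 n, derived_gap f e (ratr q1) (ratr q2) n x.
Proof.
move=> /lte_rat_between[q1 /andP[lq1 /lte_rat_between[q2 /andP[q12 q2r]]]].
have [d d0 lf] := limf_esup_right_lt _ _ lq1.
have [n] := ltr_add_invr d0; rewrite add0r => nd.
exists q1, q2, n; split => // t /andP[t0 tn].
have /lf : 0 < t < d by rewrite t0 (lt_trans tn).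
by rewrite ltr_pdivrMr// mulNr => /ltW.
Qed.

Lemma derived_gap_backward_bound f e r s n x w t u : derived_gap f e r s n w ->
  w = x + e * u -> 0 < t < u -> u < n.+1%:R^-1 ->
  `|f (x + e * t) - f x| <= r * (2 * u - t).
Proof.
move=> [_ _ _ fw] wE /andP[t0 tu] un.
have /fw : 0 < u < n.+1%:R^-1 by rewrite (lt_trans t0).
have /fw : 0 < u - t < n.+1%:R^-1.
  by rewrite subr_gt0 tu (lt_trans _ un)// ltrBlDr ltrDl.
have -> : w - e * (u - t) = x + e * t by rewrite wE; ring.
have -> : w - e * u = x by rewrite wE; ring.
rewrite [in X in _ -> X -> _]distrC => le1 le2.
apply: le_trans (ler_distD (f w) _ _) _.
lra.
Qed.

Lemma porous_derived_gap f e r s n : e ^+ 2 = 1 -> porous (derived_gap f e r s n).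
Proof.
move=> e2 x [_ rs sf _].
have e1 : `|e| = 1 by apply/eqP; rewrite -sqrp_eq1// real_normK ?num_real// e2.
(* Since [2 * a * r <= 2 * a * |r| < s - r], this choice gives [r * (1 + 2 * a) < s]; the added 1
   keeps the denominator positive. *)
pose a := (s - r) / (2 * (`|r| + 1)).
have r1 : 0 < `|r| + 1 by rewrite ltr_pwDr.
have a0 : 0 < a by rewrite divr_gt0 ?mulr_gt0 ?subr_gt0.
have ras : r * (1 + 2 * a) < s.
  have aE : 2 * a * (`|r| + 1) = s - r.
    by rewrite /a; field; rewrite gt_eqF.
  have : r * a <= `|r| * a by rewrite ler_pM2r// ler_norm.
  nra.
(* A hole of radius [a * t / 2] in a ball of radius [t * (1 + a)] has this ratio. *)
apply: (@upper_porosity_gt0 _ _ _ (a / (2 * (1 + a)))).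
  by rewrite divr_gt0//; lra.
move=> d d0.
(* Dividing by [1 + a] keeps the far end of the hole, at distance [t * (1 + a)], within both [d] and
   the scale of [n]. *)
have [|t /andP[t0]] := limf_esup_right_gt _ _ sf (Num.min d n.+1%:R^-1 / (1 + a)).
  by rewrite divr_gt0 ?lt_min ?d0 ?invr_gt0 ?ltr0n//; lra.
rewrite ltr_pdivlMr ?addr_gt0// lt_min => /andP[td tn].
rewrite ltr_pdivlMr// => st.
exists (t * (1 + a)), (x + e * (t * (1 + a / 2))); split.
  by rewrite td andbT mulr_gt0// addr_gt0.
have -> : a / (2 * (1 + a)) * (t * (1 + a)) = a * t / 2.
  by field; rewrite gt_eqF// addr_gt0.
move=> w; rewrite /ball/= => wz.
(* The displacement of [w] from [x] in the direction [e]. *)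
pose u := e * (w - x).
have wE : w = x + e * u by rewrite /u mulrA -expr2 e2 mul1r addrC subrK.
have : `|t * (1 + a / 2) - u| < a * t / 2.
  suff -> : t * (1 + a / 2) - u = e * (x + e * (t * (1 + a / 2)) - w).
    by rewrite normrM e1 mul1r.
  by rewrite -[t * _ in LHS]mul1r -e2 /u; ring.
rewrite ltr_distl => /andP[u1 u2].
have tu : t < u by nra.
have ua : u < t * (1 + a) by nra.
split.
  rewrite /ball/= wE opprD addNKr normrN normrM e1 mul1r gtr0_norm//.
  exact: lt_trans tu.
move=> gapw.
have := derived_gap_backward_bound _ _ _ _ _ _ _ t _ gapw wE.
rewrite t0 tu => /(_ isT (lt_trans ua tn)) ftr.
(* For [0 <= r], [u < t * (1 + a)] gives [r * (2 * u - t) < s * t]; for [r < 0], [t < u] gives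
   [r * (2 * u - t) < r * t < s * t]. *)
have [r0|r0] := leP 0 r; nra.
Qed.

End derived_numbers.

Theorem theorem3p3 (R : realType) (X : completeNormedModType R) (f : R -> X) :
  sigma_porous [set x : R | mDright f x <> mDleft f x].
Proof.
(* The sign bit is [true] where the left derived number is the larger one. *)
pose gap (i : bool * (rat * rat * nat)) :=
  derived_gap f ((-1) ^+ i.1) (ratr i.2.1.1) (ratr i.2.1.2) i.2.2.
have -> : [set x | mDright f x <> mDleft f x] = \bigcup_i gap i.
  apply/seteqP; split=> [x /= /eqP|x [[b [[q1 q2] n]] _ [lr rs sr _]] /=].
    rewrite mDrightE mDleftE neq_lt => /orP[lt|lt].
      have [|q1 [q2 [n gapx]]] := @derived_gap_exists _ _ f (-1) x.
        by rewrite opprK.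
      by exists (true, (q1, q2, n)).
    have [q1 [q2 [n gapx]]] := @derived_gap_exists _ _ f 1 x lt.
    by exists (false, (q1, q2, n)).
  have : (mDdir f (- (-1) ^+ b) x < mDdir f ((-1) ^+ b) x)%E.
    by apply: (lt_trans lr); apply: lt_trans sr; rewrite lte_fin.
  rewrite mDrightE mDleftE.
  by case: b {lr rs sr}; rewrite /= ?expr1 ?expr0 ?opprK => /[swap] ->; rewrite ltxx.
by apply: sigma_porous_bigcup => -[b i]; apply: porous_derived_gap; rewrite sqrr_sign.
Qed.
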